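(* Let $D_n^{M,1}$ be the modified Durrmeyer operator with $a_0(n)=2$ and $a_1(n)=-3$ for all $n$. There is a constant $C>0$, independent of $n$ and $f$, such that for every $f\in C[0,1]$ and $n\ge 1$, $$\|D_n^{M,1}f-f\|_{C[0,1]}\le C\,\omega_2\left(f;\frac{1}{\sqrt n}\right).$$
   Context: For integers $n\ge 0$ and $k$, $p_{n,k}(x)=\binom{n}{k}x^k(1-x)^{n-k}$ for $0\le k\le n$, and $p_{n,k}(x)=0$ if $k<0$ or $k>n$. Put $a(x,n)=a_1(n)x+a_0(n)$ (here, $a(x,n)=2-3x$) and, for $n\ge 1$, $$p_{n,k}^{M,1}(x)=a(x,n)\,p_{n-1,k}(x)+a(1-x,n)\,p_{n-1,k-1}(x),\quad 0\le k\le n$$ (so $p_{n,0}^{M,1}(x)=a(x,n)(1-x)^{n-1}$ and $p_{n,n}^{M,1}(x)=a(1-x,n)x^{n-1}$). The operator $D_n^{M,1}$ is $$D_n^{M,1}(f;x)=(n+1)\sum_{k=0}^{n}p_{n,k}^{M,1}(x)\int_0^1 p_{n,k}(t)f(t)\,dt,\quad x\in[0,1],$$ and $D_n^{M,1}f$ denotes the function $x\mapsto D_n^{M,1}(f;x)$. $\|\cdot\|_{C[0,1]}$ is the supremum norm, and $\omega_2(f;\delta)=\sup\{|f(x+h)-2f(x)+f(x-h)|: 0<h\le\delta,\ x-h,\,x,\,x+h\in[0,1]\}$ is the second order modulus of smoothness. *)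

(* Defs.v *)
From HB Require Import structures.
From mathcomp Require Import all_boot all_order all_algebra.
From mathcomp Require Import all_classical all_reals all_analysis.
Set Implicit Arguments.
Unset Strict Implicit.
Unset Printing Implicit Defensive.
Import Order.TTheory GRing.Theory Num.Theory.
Import numFieldNormedType.Exports.
Local Open Scope classical_set_scope.
Local Open Scope ring_scope.

(* Bernstein basis polynomial p_{n,k}, for every integer k.  For k > n it
   vanishes because 'C(n, k) = 0. *)
Definition bernstein (R : realType) (n : nat) (k : int) (x : R) : R :=
  match k with
  | Posz j => 'C(n, j)%:R * x ^+ j * (1 - x) ^+ (n - j)
  | Negz _ => 0
  end.

Definition acoef (R : realType) (a0 a1 : nat -> R) (x : R) (n : nat) : R :=
  a1 n * x + a0 n.

(* p_{n,k}^{M,1}; meant for n >= 1.  The index k - 1 is computed in int, so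
   that p_{n-1,-1} = 0. *)
Definition bernsteinM1 (R : realType) (a0 a1 : nat -> R) (n : nat) (k : int)
    (x : R) : R :=
  acoef a0 a1 x n * bernstein n.-1 k x
  + acoef a0 a1 (1 - x) n * bernstein n.-1 (k - 1) x.

Definition durrmeyerM1 (R : realType) (a0 a1 : nat -> R) (n : nat)
    (f : R -> R) (x : R) : R :=
  n.+1%:R * \sum_(0 <= k < n.+1)
    bernsteinM1 a0 a1 n k%:Z x *
    \int[lebesgue_measure]_(t in `[0, 1]) (bernstein n k%:Z t * f t).

(* Supremum norm over [0, 1].  The real-valued sup is the genuine supremum
   whenever g is bounded on [0, 1], in particular when g is continuous. *)
Definition norm_C01 (R : realType) (g : R -> R) : R :=
  sup [set `|g x| | x in `[0, 1]].

(* Second order modulus of smoothness on [0, 1].  For d > 0 the set is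
   nonempty, and it is bounded when f is bounded on [0, 1]. *)
Definition omega2 (R : realType) (f : R -> R) (d : R) : R :=
  sup [set y | exists x h : R,
    [/\ 0 < h <= d,
        [/\ x - h \in `[0, 1], x \in `[0, 1] & x + h \in `[0, 1]]
      & y = `|f (x + h) - 2 * f x + f (x - h)|]].

(* Main.v *)
Require Import Defs.
From HB Require Import structures.
From mathcomp Require Import all_boot all_order all_algebra.
From mathcomp Require Import all_classical all_reals all_analysis.
From mathcomp Require Import ring lra.
Set Implicit Arguments.
Unset Strict Implicit.
Unset Printing Implicit Defensive.
Import Order.TTheory GRing.Theory Num.Theory.
Import numFieldNormedType.Exports.
Local Open Scope classical_set_scope.
Local Open Scope ring_scope.

(** The operator [D_n], with coefficient function [a(x) = 2 - 3x], reproduces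
    affine functions, since [a(x) + a(1 - x) = 1] and the first moment also comes
    out exactly.  It is not positive, but [a(x)] and [a(1 - x)] are at most 2 in
    absolute value on [[0, 1]], so it is dominated by a positive operator, twice
    the sum of two Bernstein means of Durrmeyer coefficients, for which
    [1 + n (t - x)^2] has size [O(1)] at [x].  Hence [|g t| <= K (1 + n (t - x)^2)]
    on [[0, 1]] forces [|D_n g (x)| <= 12 K] (lemma [durrmeyer_majorant]).

    It therefore suffices to find, for each point [x] separately, an affine [l]
    with [|f t - l t| <= 36 W (1 + ((t - x) / d)^2)] on [[0, 1]], where
    [d = 1 / sqrt n] and [W] is the second modulus of [f] at [d] (lemma
    [affine_approximation]): then [D_n f - f = D_n g - g] for [g = f - l], and the
    two terms at [x] are at most [12 * 36 W] and [36 W].  This choice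
    of [l], made anew at each point, plays the part of the smooth approximant in an
    argument through a K-functional.

    The affine function is the chord of [f] on an interval of length [d] that
    contains [x].  On that interval the error is at most [W], by the
    argument for Whitney's inequality; away from it, second differences with step
    [d / 2] bounded by [W] let the error grow at most quadratically in the number
    of steps. *)

(** * Bernstein means *)

(** The expectation of [phi] under the binomial law of parameters [N] and [x]. *)
Definition bernstein_mean (R : realType) (N : nat) (x : R) (phi : nat -> R) : R :=
  \sum_(0 <= k < N.+1) bernstein N k%:Z x * phi k.

Section BernsteinMean.
Variables (R : realType) (x : R).
Implicit Types (N k : nat) (phi psi : nat -> R).

Lemma bernstein_pred N k : bernstein N (k.+1%:Z - 1) x = bernstein N k%:Z x.
Proof. by rewrite intS addrC addKr. Qed.

Lemma bernstein_ge0 N (k : int) : x \in `[0, 1] -> 0 <= bernstein N k x.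
Proof.
rewrite in_itv/= => /andP[x0 x1]; case: k => //= k.
by rewrite !mulr_ge0 ?exprn_ge0 ?subr_ge0.
Qed.

Lemma bernsteinS N k : bernstein N.+1 k%:Z x =
  (1 - x) * bernstein N k%:Z x + x * bernstein N (k%:Z - 1) x.
Proof.
case: k => [|k]; first by rewrite /= !bin0 !subn0 exprS; ring.
rewrite bernstein_pred /= binS natrD subSS.
have [kN|Nk] := ltnP k N.
  by rewrite subnS -(prednK (_ : 0 < N - k)%N) ?subn_gt0//= !exprS; ring.
by rewrite (bin_small (_ : N < k.+1)%N)// exprS; ring.
Qed.

(** The next two lemmas put the two families of terms of [p_{n,k}^{M,1}], both
    indexed by [k <= n], back into the form of means of order [n - 1]. *)
Lemma bernstein_mean_low N phi :
  \sum_(0 <= k < N.+2) bernstein N k%:Z x * phi k = bernstein_mean N x phi.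
Proof. by rewrite big_nat_recr//= bin_small// !mul0r addr0. Qed.

Lemma bernstein_mean_shift N phi :
  \sum_(0 <= k < N.+2) bernstein N (k%:Z - 1) x * phi k =
  bernstein_mean N x (fun k => phi k.+1).
Proof.
rewrite big_nat_recl// [bernstein N (0%:Z - 1) x]/= mul0r add0r.
by apply: eq_bigr => k _; rewrite bernstein_pred.
Qed.

(** Condition on the outcome of one of the [N + 1] trials.  The shift of [phi]
    maps quadratic polynomials to quadratic polynomials, which is what makes the
    induction computing the moments go through. *)
Lemma bernstein_meanS N phi : bernstein_mean N.+1 x phi =
  (1 - x) * bernstein_mean N x phi + x * bernstein_mean N x (fun k => phi k.+1).
Proof.
rewrite -(bernstein_mean_low N) -bernstein_mean_shift !mulr_sumr -big_split/=.
by apply: eq_bigr => k _; rewrite bernsteinS mulrDl -!mulrA.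
Qed.

Lemma eq_bernstein_mean N phi psi :
  (forall k, (k <= N)%N -> phi k = psi k) ->
  bernstein_mean N x phi = bernstein_mean N x psi.
Proof. by move=> e; apply: eq_big_nat => k /andP[_ kN]; rewrite e. Qed.

Lemma bernstein_meanD N phi psi :
  bernstein_mean N x (fun k => phi k + psi k) =
  bernstein_mean N x phi + bernstein_mean N x psi.
Proof. by rewrite -big_split; apply: eq_bigr => k _; rewrite mulrDr. Qed.

Lemma bernstein_mean_quad N (a b c : R) :
  bernstein_mean N x (fun k => a + b * k%:R + c * k%:R ^+ 2) =
  a + b * (N%:R * x) + c * (N%:R * x + N%:R * (N%:R - 1) * x ^+ 2).
Proof.
elim: N a b c => [|N IH] a b c.
  by rewrite /bernstein_mean big_nat1 /= !expr0 !bin0; ring.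
rewrite bernstein_meanS (@eq_bernstein_mean _ (fun k => a + b * k.+1%:R + _)
  (fun k => (a + b + c) + (b + 2 * c) * k%:R + c * k%:R ^+ 2)).
  by rewrite !IH -[N.+1%:R]natr1; ring.
by move=> k _; rewrite -[k.+1%:R]natr1; ring.
Qed.

Lemma ler_norm_bernstein_mean N phi psi : x \in `[0, 1] ->
  (forall k, (k <= N)%N -> `|phi k| <= psi k) ->
  `|bernstein_mean N x phi| <= bernstein_mean N x psi.
Proof.
move=> x01 le; apply: le_trans (ler_norm_sum _ _ _) _.
apply: ler_sum_nat => k /andP[_ kN].
by rewrite normrM ger0_norm ?bernstein_ge0// ler_wpM2l ?bernstein_ge0 ?le.
Qed.

End BernsteinMean.

(** * Durrmeyer coefficients *)

(** The mean of [f] under the Beta law whose density is [(n + 1) p_{n,k}]. *)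
Definition durrmeyer_coef (R : realType) (n : nat) (f : R -> R) (k : nat) : R :=
  n.+1%:R * \int[lebesgue_measure]_(t in `[0, 1]) (bernstein n k%:Z t * f t).

Section DurrmeyerCoefficients.
Variable R : realType.
Implicit Types (f g : R -> R) (n k : nat).
Local Notation mu := (@lebesgue_measure R).

Lemma continuous_bernstein n k : continuous (bernstein n k%:Z : R -> R).
Proof.
rewrite (_ : bernstein n k%:Z =
    horner ('C(n, k)%:R%:P * 'X ^+ k * (1 - 'X) ^+ (n - k))).
  exact: continuous_horner.
by apply/funext => t; rewrite !hornerE.
Qed.

Lemma integrable_bernsteinM n k f : {within `[0, 1], continuous f} ->
  mu.-integrable `[0, 1] (EFin \o (fun t => bernstein n k%:Z t * f t)).
Proof.
move=> cf; apply: continuous_compact_integrable; first exact: segment_compact.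
move=> t; apply: cvgM; last exact: cf.
by apply: continuous_in_subspaceT => s _; exact: continuous_bernstein.
Qed.

Lemma durrmeyer_coefD n k f g :
  {within `[0, 1], continuous f} -> {within `[0, 1], continuous g} ->
  durrmeyer_coef n (fun t => f t + g t) k =
  durrmeyer_coef n f k + durrmeyer_coef n g k.
Proof.
move=> cf cg; rewrite /durrmeyer_coef -mulrDr -RintegralD//;
  try exact: integrable_bernsteinM.
by congr (_ * _); apply: eq_Rintegral => t _; rewrite mulrDr.
Qed.

Lemma durrmeyer_coefZ n k (c : R) f : {within `[0, 1], continuous f} ->
  durrmeyer_coef n (fun t => c * f t) k = c * durrmeyer_coef n f k.
Proof.
move=> cf; rewrite /durrmeyer_coef mulrCA; congr (_ * _).
rewrite -RintegralZl//; last exact: integrable_bernsteinM.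
by apply: eq_Rintegral => t _; rewrite mulrCA.
Qed.

Lemma ler_norm_durrmeyer_coef n k f g :
  {within `[0, 1], continuous f} -> {within `[0, 1], continuous g} ->
  (forall t, t \in `[0, 1] -> `|f t| <= g t) ->
  `|durrmeyer_coef n f k| <= durrmeyer_coef n g k.
Proof.
move=> cf cg fg; rewrite normrM ger0_norm// ler_wpM2l//.
have If := integrable_bernsteinM n k cf.
apply: le_trans (le_normr_Rintegral _ _) _ => //.
apply: le_Rintegral => //; first exact: integrable_norm.
  exact: integrable_bernsteinM.
move=> t t01; rewrite normrM ger0_norm ?bernstein_ge0//.
by rewrite ler_wpM2l ?bernstein_ge0 ?fg.
Qed.

Lemma integral_bernstein n k : (k <= n)%N ->
  \int[mu]_(t in `[0, 1]) bernstein n k%:Z t = n.+1%:R^-1.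
Proof.
move=> kn.
have IX := @integrable_XMonemX R k (n - k).
transitivity ('C(n, k)%:R * beta_fun k.+1 (n - k).+1 : R).
  rewrite /beta_fun -Rintegral_mkcond -RintegralZl//.
  by apply: eq_Rintegral => t _; rewrite /= -mulrA.
rewrite beta_fun_fact subnKC// mulrA -natrM bin_fact// factS natrM invfM.
by rewrite mulrCA mulrV ?mulr1// unitfE pnatr_eq0 -lt0n fact_gt0.
Qed.

(** Multiplication by [t] raises both indices of the kernel, so every moment
    reduces to the normalisation [integral_bernstein]. *)
Lemma bernsteinMX n k t :
  bernstein n k%:Z t * t = k.+1%:R / n.+1%:R * bernstein n.+1 k.+1%:Z t :> R.
Proof.
rewrite /= subSS exprSr.
have -> : 'C(n, k)%:R = k.+1%:R / n.+1%:R * 'C(n.+1, k.+1)%:R :> R.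
  by rewrite mulrAC -natrM -mul_bin_diag natrM mulrAC divff ?pnatr_eq0// mul1r.
by ring.
Qed.

Lemma durrmeyer_coef1 n k : (k <= n)%N -> durrmeyer_coef n (fun=> 1 : R) k = 1.
Proof.
move=> kn; rewrite /durrmeyer_coef; under eq_Rintegral do rewrite mulr1.
by rewrite integral_bernstein// divff// pnatr_eq0.
Qed.

Lemma durrmeyer_coefX n k f : {within `[0, 1], continuous f} ->
  durrmeyer_coef n (fun t => t * f t) k =
  k.+1%:R / n.+2%:R * durrmeyer_coef n.+1 f k.+1.
Proof.
move=> cf; rewrite /durrmeyer_coef.
have -> : \int[mu]_(t in `[0, 1]) (bernstein n k%:Z t * (t * f t)) =
    k.+1%:R / n.+1%:R *
    \int[mu]_(t in `[0, 1]) (bernstein n.+1 k.+1%:Z t * f t).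
  rewrite -RintegralZl//; last exact: integrable_bernsteinM.
  by apply: eq_Rintegral => t _; rewrite mulrA bernsteinMX !mulrA.
by field; have := ler0n R n; lra.
Qed.

Lemma durrmeyer_coef_quad n k (a b c : R) : (k <= n)%N ->
  durrmeyer_coef n (fun t => a + b * t + c * t ^+ 2) k =
  a + b * (k.+1%:R / n.+2%:R)
    + c * (k.+1%:R * k.+2%:R / (n.+2%:R * n.+3%:R)).
Proof.
move=> kn.
have cst1 : {within `[0, 1], continuous (fun _ : R => 1 : R)}.
  by apply: continuous_subspaceT => t; exact: cvg_cst.
have cX f : {within `[0, 1], continuous f} ->
    {within `[0, 1], continuous (fun t : R => t * f t)}.
  move=> cf t; apply: cvgM; last exact: cf.
  by apply: continuous_subspaceT => s; exact: cvg_id.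
have cid : {within `[0, 1], continuous (fun t : R => t * 1)}.
  exact: cX.
have csq : {within `[0, 1], continuous (fun t : R => t * (t * 1))}.
  exact: cX.
have cZ (e : R) f : {within `[0, 1], continuous f} ->
    {within `[0, 1], continuous (fun t : R => e * f t)}.
  by move=> cf t; apply: cvgM; [exact: cvg_cst|exact: cf].
(* The trailing factors 1 end each chain of multiplications by t at a constant. *)
transitivity (durrmeyer_coef n
    (fun t => a * 1 + b * (t * 1) + c * (t * (t * 1))) k).
  by congr (_ * _); apply: eq_Rintegral => t _; rewrite !mulr1.
rewrite durrmeyer_coefD; [|by apply: within_continuousD; exact: cZ|exact: cZ].
rewrite durrmeyer_coefD; [|exact: cZ..].
rewrite !durrmeyer_coefZ// !durrmeyer_coefX// !durrmeyer_coef1//.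
by field; have := ler0n R n; lra.
Qed.

End DurrmeyerCoefficients.

(** * Local affine approximation under a second difference bound *)

(** An explicit bound rather than a modulus, so that restriction to a subinterval,
    reflection and subtraction of an affine function do not involve suprema. *)
Definition second_diff_le (R : realType) (f : R -> R) (a b d W : R) :=
  forall u k, 0 < k <= d -> a <= u - k -> u + k <= b ->
    `|f (u + k) - 2 * f u + f (u - k)| <= W.

Section AffineApproximation.
Variable R : realType.
Implicit Types (f g : R -> R) (a b d W : R).

Lemma second_diff_le_sub_affine f a b d W (al be : R) :
  second_diff_le f a b d W ->
  second_diff_le (fun t => f t - (al + be * t)) a b d W.
Proof.
move=> fW u k kd au ub; rewrite [X in `|X|](_ : _ = f (u + k) - 2 * f u + f (u - k)).
  exact: fW.
by ring.
Qed.

Lemma second_diff_le_reflect f a b d W : second_diff_le f a b d W ->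
  second_diff_le (fun t => f (1 - t)) (1 - b) (1 - a) d W.
Proof.
move=> fW u k kd au ub.
rewrite (_ : 1 - (u + k) = 1 - u - k); last by ring.
rewrite (_ : 1 - (u - k) = 1 - u + k); last by ring.
have := fW (1 - u) k kd ltac:(lra) ltac:(lra).
rewrite [X in `|X| <= _](_ : _ =
  f (1 - u - k) - 2 * f (1 - u) + f (1 - u + k)) //; by ring.
Qed.

Lemma second_diff_le_ge0 f d W :
  0 < d <= 1 -> second_diff_le f 0 1 d W -> 0 <= W.
Proof.
move=> d01 fW.
by apply: le_trans (fW (1 / 2) (d / 2) _ _ _); [exact: normr_ge0|..]; lra.
Qed.

(** Whitney's inequality for chords.  If [M] is the supremum of [|g|] and [t] lies
    in the left half, the second difference with step [t - a] compares [2 g(t)]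
    with [g(a) = 0] and one other value, so [2 |g(t)| <= M + W]; symmetrically on
    the right.  Taking the supremum over [t], [2 M <= M + W]. *)
Lemma second_diff_le_chord g a b d W : a < b -> b - a <= 2 * d ->
  second_diff_le g a b d W -> has_ubound [set `|g t| | t in `[a, b]] ->
  g a = 0 -> g b = 0 -> forall t, t \in `[a, b] -> `|g t| <= W.
Proof.
move=> ab abd gW ubg ga gb.
set M := sup [set `|g t| | t in `[a, b]].
have leM t : a <= t <= b -> `|g t| <= M.
  by move=> tab; apply: ub_le_sup => //; exists t => //=; rewrite in_itv.
have W0 : 0 <= W.
  apply: le_trans (gW ((a + b) / 2) ((b - a) / 2) _ _ _); try lra.
  exact: normr_ge0.
have M0 : 0 <= M by apply: le_trans (leM a _); [exact: normr_ge0|lra].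
suff MW : M <= (M + W) / 2.
  by move=> t; rewrite in_itv/= => /leM tM; apply: le_trans tM _; lra.
apply: ge_sup; first by exists `|g a|, a => //=; rewrite in_itv/= lexx ltW.
move=> _ [t /= + <-]; rewrite in_itv/= => /andP[at_ tb].
have [->|ta] := eqVneq t a; first by rewrite ga normr0; lra.
have [->|tb'] := eqVneq t b; first by rewrite gb normr0; lra.
have {ta} ta : a < t by rewrite lt_neqAle eq_sym ta.
have {tb'} tb' : t < b by rewrite lt_neqAle tb'.
have [tm|tm] := leP t ((a + b) / 2).
- have := gW t (t - a); rewrite (_ : t - (t - a) = a) ?ga; last by ring.
  have := leM (t + (t - a)).
  rewrite !ler_norml => A B.
  have /andP[A1 A2] : - M <= g (t + (t - a)) <= M by apply: A; lra.
  have /andP[B1 B2] := B ltac:(lra) ltac:(lra) ltac:(lra).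
  by apply/andP; split; lra.
- have := gW t (b - t); rewrite (_ : t + (b - t) = b) ?gb; last by ring.
  have := leM (t - (b - t)).
  rewrite !ler_norml => A B.
  have /andP[A1 A2] : - M <= g (t - (b - t)) <= M by apply: A; lra.
  have /andP[B1 B2] := B ltac:(lra) ltac:(lra) ltac:(lra).
  by apply/andP; split; lra.
Qed.

(** Discrete double integration: [g(t) - g(t - h)] grows by at most [W] per step
    of length [h], hence linearly in the number [j] of steps, and [g] itself
    quadratically. *)
Lemma second_diff_le_extend g a B h W : 0 < h -> 0 <= W ->
  second_diff_le g a B h W ->
  (forall t, a <= t <= B -> t <= a + 2 * h -> `|g t| <= W) ->
  forall (j : nat) t, a <= t <= B -> t <= a + 2 * h + j%:R * h ->
    `|g t| <= (1 + j%:R) * (2 + j%:R) * W.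
Proof.
move=> h0 W0 gW gloc.
have step (j : nat) : forall t, a + h <= t <= B -> t <= a + 2 * h + j%:R * h ->
    `|g t - g (t - h)| <= (2 + j%:R) * W.
  elim: j => [|j IH] t tB tj.
    rewrite mul0r addr0 in tj *.
    apply: le_trans (ler_normB _ _) _.
    have := gloc t ltac:(lra) ltac:(lra).
    have := gloc (t - h) ltac:(lra) ltac:(lra).
    by lra.
  have jh0 : 0 <= j%:R * h by rewrite mulr_ge0 ?ler0n// ltW.
  have jW0 : 0 <= j%:R * W by rewrite mulr_ge0 ?ler0n.
  rewrite -natr1 in tj *.
  have [tl|tg] := leP t (a + 2 * h).
    apply: le_trans (ler_normB _ _) _.
    have := gloc t ltac:(lra) ltac:(lra).
    have := gloc (t - h) ltac:(lra) ltac:(lra).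
    by lra.
  have := IH (t - h) ltac:(lra) ltac:(lra).
  have := gW (t - h) h ltac:(lra) ltac:(lra) ltac:(lra).
  rewrite subrK !ler_norml => /andP[A1 A2] /andP[B1 B2].
  by apply/andP; split; lra.
elim=> [|j IH] t tB tj.
  rewrite mul0r addr0 in tj *.
  by have := gloc t ltac:(lra) ltac:(lra); lra.
have jh0 : 0 <= j%:R * h by rewrite mulr_ge0 ?ler0n// ltW.
have jW0 : 0 <= j%:R * W by rewrite mulr_ge0 ?ler0n.
have jjW0 : 0 <= j%:R * j%:R * W by rewrite !mulr_ge0 ?ler0n.
have [tl|tg] := leP t (a + 2 * h).
  by have := gloc t ltac:(lra) ltac:(lra); rewrite -natr1; lra.
have := step j.+1 t ltac:(lra) tj.
rewrite -natr1 in tj *.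
have := IH (t - h) ltac:(lra) ltac:(lra).
rewrite !ler_norml => /andP[A1 A2] /andP[B1 B2].
by apply/andP; split; lra.
Qed.

(** The chord of [f] over an interval of length [d] around [x], extended to the
    right and, after reflection, to the left.  The affine function depends on [x]
    but the constant does not. *)
Lemma affine_approximation f d W x : 0 < d <= 1 -> x \in `[0, 1] ->
  has_ubound [set `|f t| | t in `[0, 1]] -> second_diff_le f 0 1 d W ->
  exists al be : R, forall t, t \in `[0, 1] ->
    `|f t - (al + be * t)| <= 36 * W * (1 + ((t - x) / d) ^+ 2).
Proof.
rewrite in_itv/= => d01 /andP[x0 x1] [K fK] fW.
have W0 := second_diff_le_ge0 d01 fW.
(* An interval [a, a + d] inside [0, 1] around x; d <= 1 leaves room for it. *)
have [a [a0 ad1 ax xa]] : exists a, [/\ 0 <= a, a + d <= 1, a <= x & x <= a + d].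
  by have [xd|xd] := leP x (1 - d); [exists x|exists (1 - d)]; split; lra.
pose be := (f (a + d) - f a) / d; pose al := f a - be * a.
exists al, be; set g := fun t => f t - (al + be * t).
have gW : second_diff_le g 0 1 d W by exact: second_diff_le_sub_affine.
have gloc t : a <= t <= a + d -> `|g t| <= W.
  move=> tad; apply: (@second_diff_le_chord g a (a + d) d W); try lra.
  - by move=> u k ku au ub; apply: gW; lra.
  - exists (K + (`|al| + `|be|)) => _ [s /= + <-]; rewrite in_itv/= => sad.
    apply: le_trans (ler_normB _ _) _; apply: lerD.
      by apply: fK; exists s => //=; rewrite in_itv/=; lra.
    apply: le_trans (ler_normD _ _) _; rewrite lerD2l normrM ler_piMr//.
    by rewrite ger0_norm; lra.
  - by rewrite /g /al; ring.
  - by rewrite /g /al /be; field; lra.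
  - by rewrite in_itv.
move=> t; rewrite in_itv/= => t01.
(* The step is d / 2, so that two steps fit in [a, a + d]; j steps from that
   interval reach t. *)
pose h := d / 2; pose r := `|t - x| / h; pose j := (Num.trunc r).+1.
have h0 : 0 < h by rewrite /h; lra.
have r0 : 0 <= r by rewrite divr_ge0// ltW.
have rj : r < j%:R by have /andP[] := truncn_itv r0.
have jr : j%:R <= r + 1 by rewrite -natr1 lerD2r truncn_le.
have txj : `|t - x| <= j%:R * h by rewrite -ler_pdivrMr// ltW.
have [txj1 txj2] : t - x <= j%:R * h /\ - (j%:R * h) <= t - x.
  by move: txj; rewrite ler_norml => /andP[].
have gj : `|g t| <= (1 + j%:R) * (2 + j%:R) * W.
  have [ta|ta] := leP a t.
    apply: (@second_diff_le_extend g a 1 h W) => //.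
    - by move=> u k kh au ub; apply: gW; rewrite ?/h in kh *; lra.
    - by move=> s sB sa; apply: gloc; rewrite /h in sa; lra.
    - lra.
    - by rewrite /h in txj1 *; lra.
  (* To the left of a, extend the reflection of g about 1/2. *)
  have := @second_diff_le_extend (fun s => g (1 - s)) (1 - (a + d)) 1 h W
    h0 W0 _ _ j (1 - t).
  rewrite subKr; apply.
  - move=> u k kh au ub.
    apply: (@second_diff_le_reflect g 0 (a + d) d W); rewrite /h in kh *; try lra.
    by move=> u' k' k'h au' ub'; apply: gW; lra.
  - by move=> s sB sa; apply: gloc; rewrite /h in sa; lra.
  - lra.
  - by rewrite /h in txj2 *; lra.
have -> : ((t - x) / d) ^+ 2 = r ^+ 2 / 4.
  by rewrite /r /h !expr_div_n real_normK ?num_real//; field; lra.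
apply: le_trans gj _.
(* Since r = 2 |t - x| / d, the bound 9 (1 + r^2) is at most 36 (1 + (r / 2)^2). *)
have : (1 + j%:R) * (2 + j%:R) <= 9 * (1 + r ^+ 2) :> R.
  apply: (@le_trans _ _ ((2 + r) * (3 + r))).
    by apply: ler_pM; lra.
  by have := sqr_ge0 (r - 1); have := sqr_ge0 r; lra.
move=> /(ler_wpM2r W0) /le_trans; apply.
have : 0 <= W * r ^+ 2 by rewrite mulr_ge0 ?sqr_ge0.
by lra.
Qed.

End AffineApproximation.

(** * The modified Durrmeyer operator *)

Section ModifiedDurrmeyer.
Variable R : realType.
Implicit Types (f g : R -> R) (x : R) (n k N : nat).

Lemma durrmeyerM1E (a0 a1 : nat -> R) N f x :
  durrmeyerM1 a0 a1 N.+1 f x =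
  acoef a0 a1 x N.+1 * bernstein_mean N x (durrmeyer_coef N.+1 f)
  + acoef a0 a1 (1 - x) N.+1 *
    bernstein_mean N x (fun k => durrmeyer_coef N.+1 f k.+1).
Proof.
rewrite -(bernstein_mean_low x N) -bernstein_mean_shift /durrmeyerM1 !mulr_sumr.
rewrite -big_split.
by apply: eq_bigr => k _; rewrite /bernsteinM1 /durrmeyer_coef /=; ring.
Qed.

Local Notation D := (durrmeyerM1 (fun=> 2 : R) (fun=> - 3)).

Lemma durrmeyerD N f g x :
  {within `[0, 1], continuous f} -> {within `[0, 1], continuous g} ->
  D N.+1 (fun t => f t + g t) x = D N.+1 f x + D N.+1 g x.
Proof.
move=> cf cg; rewrite !durrmeyerM1E.
do 2!rewrite (eq_bernstein_mean _ (fun k _ => durrmeyer_coefD N.+1 _ cf cg))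
  bernstein_meanD.
by ring.
Qed.

(** With [N = n - 1], the two means of the coefficients of [t] are
    [(N x + 1) / (N + 3)] and [(N x + 2) / (N + 3)]; weighted by [2 - 3 x] and
    [3 x - 1] they add up to exactly [x]. *)
Lemma durrmeyer_affine N (al be : R) x :
  D N.+1 (fun t => al + be * t) x = al + be * x.
Proof.
have -> : (fun t => al + be * t) = (fun t => al + be * t + 0 * t ^+ 2).
  by apply/funext => t; rewrite mul0r addr0.
have nz := (ler0n R N).
rewrite durrmeyerM1E /acoef.
rewrite (@eq_bernstein_mean _ _ N (durrmeyer_coef _ _) (fun k =>
   (al + be / N.+3%:R) + be / N.+3%:R * k%:R + 0 * k%:R ^+ 2)); last first.
  move=> k kN; rewrite durrmeyer_coef_quad ?leqW// mul0r mul0r.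
  rewrite -[k.+1%:R]natr1; field.
  by lra.
rewrite (@eq_bernstein_mean _ _ N (fun k => durrmeyer_coef _ _ _) (fun k =>
   (al + 2 * be / N.+3%:R) + be / N.+3%:R * k%:R + 0 * k%:R ^+ 2)); last first.
  move=> k kN; rewrite durrmeyer_coef_quad// mul0r mul0r.
  rewrite -[k.+2%:R]natr1 -[k.+1%:R]natr1; field.
  by lra.
rewrite !bernstein_mean_quad -[N.+3%:R]natr1 -[N.+2%:R]natr1 -[N.+1%:R]natr1.
by field; lra.
Qed.

Definition majorant (K nu x t : R) := K * (1 + nu * (t - x) ^+ 2).

(** The mean of [(t - x)^2] is [P / ((N + 3) (N + 4))] with [P] equal to
    [2 N x (1 - x)] plus a bounded term: the [N^2] contributions cancel, which
    gives the decay in [1 / n].  The shift [s] covers both families of terms. *)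
Lemma bernstein_mean_majorant N s x (K : R) : (s <= 1)%N -> 0 <= K ->
  x \in `[0, 1] ->
  bernstein_mean N x
    (fun k => durrmeyer_coef N.+1 (majorant K N.+1%:R x) (k + s)) <= 3 * K.
Proof.
move=> s1 K0; rewrite in_itv/= => /andP[x0 x1].
pose nu := N%:R : R; have nu0 : 0 <= nu := ler0n _ _.
pose sg := s%:R : R.
pose n := nu + 1.
rewrite (_ : majorant _ _ _ =
    (fun t => K * (1 + n * x ^+ 2) + (- 2 * K * n * x) * t + K * n * t ^+ 2));
    last first.
  by apply/funext => t; rewrite /majorant -[N.+1%:R]natr1 /n /nu; ring.
pose B := - 2 * K * n * x / (nu + 3); pose C := K * n / ((nu + 3) * (nu + 4)).
rewrite (@eq_bernstein_mean _ _ N _ (fun k =>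
   (K * (1 + n * x ^+ 2) + B * (sg + 1) + C * ((sg + 1) * (sg + 2))) +
   (B + C * (2 * sg + 3)) * k%:R + C * k%:R ^+ 2)); last first.
  move=> k kN; rewrite durrmeyer_coef_quad; last first.
    by rewrite -addn1 leq_add.
  rewrite -[(k + s).+2%:R]natr1 -[(k + s).+1%:R]natr1 natrD.
  rewrite -[N.+4%:R]natr1 -[N.+3%:R]natr1 -[N.+2%:R]natr1 -[N.+1%:R]natr1.
  rewrite -/nu -/sg /B /C; field; rewrite !gt_eqF//; lra.
rewrite bernstein_mean_quad -/nu.
pose P := 2 * nu * (x * (1 - x)) + 12 * x ^+ 2 - (8 + 8 * sg) * x
  + (sg + 1) * (sg + 2).
rewrite [leLHS](_ : _ = K * (1 + n * P / ((nu + 3) * (nu + 4)))); last first.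
  rewrite /B /C /P /n; field; rewrite !gt_eqF//; lra.
rewrite [leRHS]mulrC ler_wpM2l// -lerBrDl ler_pdivrMr; last by rewrite mulr_gt0; lra.
(* From x (1 - x) <= 1/4, and x^2 <= x for the bounded part. *)
have PN : P <= nu / 2 + 6.
  have x2 : x ^+ 2 <= x by rewrite expr2 ler_piMl.
  have : 0 <= nu * (2 * x - 1) ^+ 2 by rewrite mulr_ge0 ?sqr_ge0.
  by rewrite /P /sg; case: s s1 {sg P B C} => [|[|]]// _; lra.
have : n * P <= n * (nu / 2 + 6) by rewrite ler_wpM2l// /n; lra.
have := sqr_ge0 nu.
by rewrite /n; lra.
Qed.

Lemma continuous_majorant (K nu x : R) :
  {within `[0, 1], continuous (majorant K nu x)}.
Proof.
rewrite (_ : majorant _ _ _ = horner (K%:P * (1 + nu%:P * ('X - x%:P) ^+ 2))).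
  by apply: continuous_subspaceT => t; exact: continuous_horner.
by apply/funext => t; rewrite /majorant !hornerE.
Qed.

Lemma durrmeyer_majorant N g x (K : R) : 0 <= K -> x \in `[0, 1] ->
  {within `[0, 1], continuous g} ->
  (forall t : R, t \in `[0, 1] -> `|g t| <= majorant K N.+1%:R x t) ->
  `|D N.+1 g x| <= 12 * K.
Proof.
move=> K0 x01 cg gK; have := x01; rewrite in_itv/= => /andP[x0 x1].
have cK := @continuous_majorant K N.+1%:R x.
have coefK k := ler_norm_durrmeyer_coef N.+1 k cg cK gK.
have mean s : (s <= 1)%N ->
    `|bernstein_mean N x (fun k => durrmeyer_coef N.+1 g (k + s))| <= 3 * K.
  move=> s1; apply: le_trans (bernstein_mean_majorant N s1 K0 x01).
  by apply: ler_norm_bernstein_mean.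
have m0 : `|bernstein_mean N x (durrmeyer_coef N.+1 g)| <= 3 * K.
  by rewrite -(eq_bernstein_mean _ (fun k _ => congr1 _ (addn0 k))) mean.
have m1 : `|bernstein_mean N x (fun k => durrmeyer_coef N.+1 g k.+1)| <= 3 * K.
  by rewrite -(eq_bernstein_mean _ (fun k _ => congr1 _ (addn1 k))) mean.
rewrite durrmeyerM1E; apply: le_trans (ler_normD _ _) _; rewrite !normrM.
have A0 : `|acoef (fun=> 2) (fun=> - 3) x N.+1| <= 2 :> R.
  by rewrite ler_norml /acoef; lra.
have A1 : `|acoef (fun=> 2) (fun=> - 3) (1 - x) N.+1| <= 2 :> R.
  by rewrite ler_norml /acoef; lra.
have := ler_pM (normr_ge0 _) (normr_ge0 _) A0 m0.
have := ler_pM (normr_ge0 _) (normr_ge0 _) A1 m1.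
by lra.
Qed.

Lemma continuous_bounded01 f : {within `[0, 1], continuous f} ->
  exists K, forall t, t \in `[0, 1] -> `|f t| <= K.
Proof.
move=> cf; have cpt := continuous_compact cf (@segment_compact R 0 1).
have [M [_ HM]] := compact_bounded cpt.
exists (M + 1) => t t01; apply: (HM (M + 1)); first by rewrite ltrDl.
by exists t.
Qed.

Lemma second_diff_le_omega2 f d : {within `[0, 1], continuous f} ->
  second_diff_le f 0 1 d (omega2 f d).
Proof.
move=> /continuous_bounded01[K fK] u k kd u0 u1.
have k0 : 0 < k by case/andP: kd.
apply: ub_le_sup; last first.
  by exists u, k; split=> //; split; rewrite in_itv/=; lra.
exists (K + 2 * K + K) => _ [v [h [_ [v0 vv v1] ->]]].
apply: le_trans (ler_normD _ _) _; rewrite lerD ?fK//.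
apply: le_trans (ler_normB _ _) _; rewrite lerD ?fK//.
by rewrite normrM ger0_norm// ler_wpM2l ?fK.
Qed.

End ModifiedDurrmeyer.

Theorem theorem2p8 (R : realType) :
  exists2 C : R, 0 < C &
    forall f : R -> R, {within `[0, 1], continuous f} ->
    forall n : nat, (1 <= n)%N ->
      norm_C01 (fun x => durrmeyerM1 (fun=> 2) (fun=> - 3) n f x - f x)
      <= C * omega2 f (1 / Num.sqrt n%:R).
Proof.
(* 468 = 36 * (12 + 1). *)
exists 468 => // f cf [//|N] _.
set d := 1 / Num.sqrt N.+1%:R; set W := omega2 f d.
have sq0 : 0 < Num.sqrt (N.+1%:R : R) by rewrite sqrtr_gt0 ltr0n.
have d01 : 0 < d <= 1.
  by rewrite /d divr_gt0//= ler_pdivrMr// mul1r -[leLHS]sqrtr1 ler_wsqrtr// ler1n.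
have fW : second_diff_le f 0 1 d W by exact: second_diff_le_omega2.
have W0 := second_diff_le_ge0 d01 fW.
apply: ge_sup.
  by eexists; exists 0 => //=; rewrite in_itv/= lexx ler01.
move=> _ [x /= x01 <-].
have [K fK] := continuous_bounded01 cf.
have [|al [be fl]] := affine_approximation d01 x01 _ fW.
  by exists K => _ [t t01 <-]; exact: fK.
pose l t := al + be * t; pose g t := f t - l t.
have cl : {within `[0, 1], continuous l}.
  apply: continuous_subspaceT => t; apply: cvgD; first exact: cvg_cst.
  by apply: cvgM; [exact: cvg_cst|exact: cvg_id].
have cg : {within `[0, 1], continuous g} by exact: within_continuousB.
have gK t : t \in `[0, 1] -> `|g t| <= majorant (36 * W) N.+1%:R x t.
  move=> /fl; rewrite /majorant; congr (_ <= _ * (1 + _)).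
  rewrite expr_div_n /d expr_div_n expr1n div1r invrK sqr_sqrtr ?ler0n//.
  by rewrite mulrC.
have -> : durrmeyerM1 (fun=> 2) (fun=> - 3) N.+1 f x - f x =
    durrmeyerM1 (fun=> 2) (fun=> - 3) N.+1 g x - g x.
  have {1}-> : f = (fun t => g t + l t).
    by apply/funext => t; rewrite /g subrK.
  by rewrite durrmeyerD// durrmeyer_affine /g /l; ring.
have W36 : 0 <= 36 * W by lra.
apply: le_trans (ler_normB _ _) _.
have := durrmeyer_majorant W36 x01 cg gK.
have := gK x x01; rewrite /majorant subrr expr0n mulr0 addr0.
by lra.
Qed.
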